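(* Tree Augmentation, in the special case where the tree $\overrightarrow{T}$ consists of exactly two directed paths ending at the root (two arms), can be solved optimally in polynomial time using dynamic programming.
   Context: Tree Augmentation: the input is a mixed graph $G=(V,E\cup\overrightarrow{T})$ where $E$ is a set of undirected edges and $\overrightarrow{T}$ is a set of arcs forming a spanning tree of $V$ with all arcs directed towards a root vertex $d$. A feasible solution is an orientation $\overrightarrow{E'}$ of a subset $E'\subseteq E$ such that $(V,\overrightarrow{T}\cup\overrightarrow{E'})$ is acyclic. A vertex $u$ is covered if $\overrightarrow{E'}$ contains an arc leaving $u$. The objective is to maximize the number of covered vertices. In the two-arm case, $\overrightarrow{T}$ is the union of two directed paths $\ell_{n_\ell}\to\cdots\to\ell_1\to d$ and $r_{n_r}\to\cdots\to r_1\to d$ sharing only $d$. *)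

(* Defs.v *)
From mathcomp Require Import all_boot.

Set Implicit Arguments.
Unset Strict Implicit.
Unset Printing Implicit Defensive.

(******************************************************************************)
(* Time is measured on a random access machine with structured control flow:  *)
(* a program uses finitely many registers and an unbounded memory with        *)
(* indirect addressing, all holding natural numbers.  Every elementary        *)
(* operation costs one step.  There is deliberately no multiplication: with   *)
(* addition and truncated subtraction only, bit lengths grow by at most a     *)
(* constant per step, so unit-cost polynomial time is polynomial time on      *)
(* Turing machines.                                                           *)
(******************************************************************************)

Inductive expr : Type :=
| Const of nat
| Reg of nat
| Fetch of expr
| Add of expr & expr
| Sub of expr & expr.

Inductive cmd : Type :=
| Skip
| Assign of nat & expr
| Store of expr & expr
| Seq of cmd & cmd
| If of expr & cmd & cmd
| While of expr & cmd.

Record state : Type := State { reg : nat -> nat; mem : nat -> nat }.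

Definition update (f : nat -> nat) (x v : nat) : nat -> nat :=
  fun y => if y == x then v else f y.

Fixpoint eval (s : state) (e : expr) : nat :=
  match e with
  | Const a => a
  | Reg x => reg s x
  | Fetch e1 => mem s (eval s e1)
  | Add e1 e2 => eval s e1 + eval s e2
  | Sub e1 e2 => eval s e1 - eval s e2
  end.

Fixpoint ecost (e : expr) : nat :=
  match e with
  | Const _ | Reg _ => 1
  | Fetch e1 => (ecost e1).+1
  | Add e1 e2 | Sub e1 e2 => (ecost e1 + ecost e2).+1
  end.

(* [exec c s t s'] : started in s, the command c halts in s' after t steps.   *)
(* Tests succeed on nonzero values.                                           *)
Inductive exec : cmd -> state -> nat -> state -> Prop :=
| exec_skip s :
    exec Skip s 1 s
| exec_assign x e s :
    exec (Assign x e) s (ecost e).+1 (State (update (reg s) x (eval s e)) (mem s))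
| exec_store e1 e2 s :
    exec (Store e1 e2) s (ecost e1 + ecost e2).+1
      (State (reg s) (update (mem s) (eval s e1) (eval s e2)))
| exec_seq c1 c2 s1 s2 s3 t1 t2 :
    exec c1 s1 t1 s2 -> exec c2 s2 t2 s3 -> exec (Seq c1 c2) s1 (t1 + t2) s3
| exec_if_true e c1 c2 s s' t :
    eval s e != 0 -> exec c1 s t s' -> exec (If e c1 c2) s (ecost e + t).+1 s'
| exec_if_false e c1 c2 s s' t :
    eval s e = 0 -> exec c2 s t s' -> exec (If e c1 c2) s (ecost e + t).+1 s'
| exec_while_true e c s1 s2 s3 t1 t2 :
    eval s1 e != 0 -> exec c s1 t1 s2 -> exec (While e c) s2 t2 s3 ->
    exec (While e c) s1 (ecost e + t1 + t2).+1 s3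
| exec_while_false e c s :
    eval s e = 0 -> exec (While e c) s (ecost e).+1 s.

Definition init (w : seq nat) : state := State (fun=> 0) (nth 0 w).

Definition stores (s : state) (w : seq nat) : Prop :=
  forall i, i < size w -> mem s i = nth 0 w i.

(* A search problem: inputs i satisfying the promise [valid i], and for each  *)
(* of them a set of acceptable outputs [sol i].  The output word is read at   *)
(* the beginning of the memory.                                               *)
Definition solvable_in_poly_time (I : Type) (O : I -> Type)
    (valid : I -> Prop) (sol : forall i, O i -> Prop)
    (code_in : I -> seq nat) (code_out : forall i, O i -> seq nat) : Prop :=
  exists (prog : cmd) (a k : nat), forall i : I, valid i ->
    exists (t : nat) (s : state) (o : O i),
      [/\ exec prog (init (code_in i)) t s,
          t <= a * size (code_in i) ^ k + a,
          sol i o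
        & stores s (code_out i o)].

Section TreeAugmentation.

Variable V : finType.
Implicit Types (E : {set {set V}}) (T A B : {set V * V}) (d u v : V).

Definition arc A : rel V := [rel u v | (u, v) \in A].

Definition acyclic A : Prop :=
  forall s : seq V, s != [::] -> ~~ cycle (arc A) s.

(* Every vertex has exactly one directed walk to the root.                    *)
Definition spanning_in_tree T d : Prop :=
  forall v, exists! p : seq V, path (arc T) v p /\ last v p = d.

Definition orientation_of_subset E A : Prop :=
  forall u v, (u, v) \in A -> [set u; v] \in E /\ (v, u) \notin A.

Definition feasible E T A : Prop :=
  orientation_of_subset E A /\ acyclic (T :|: A).

Definition covered A u : bool := [exists v, (u, v) \in A].

Definition num_covered A : nat := #|[set u | covered A u]|.

Definition optimal E T A : Prop :=
  feasible E T A /\ forall B, feasible E T B -> num_covered B <= num_covered A.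

Definition path_arcs (s : seq V) : seq (V * V) := zip s (behead s).

(* The arms are listed from the leaf to the child of the root:                *)
(* l = [:: l_nl; ...; l_1] and r = [:: r_nr; ...; r_1].                       *)
Definition two_arms T d : Prop :=
  exists l r : seq V,
    [/\ l != [::], r != [::], uniq (d :: l ++ r), d :: l ++ r =i V
      & T = [set a in path_arcs (rcons l d) ++ path_arcs (rcons r d)]].

End TreeAugmentation.

Record mixed_graph : Type := MixedGraph {
  order : nat;
  root : 'I_order;
  edges : {set {set 'I_order}};
  tree : {set 'I_order * 'I_order}
}.

Definition tree_augmentation_instance (G : mixed_graph) : Prop :=
  (forall e, e \in edges G -> #|e| = 2) /\ spanning_in_tree (tree G) (root G).

Definition two_arm_instance (G : mixed_graph) : Prop :=
  tree_augmentation_instance G /\ two_arms (tree G) (root G).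

Definition optimal_solution (G : mixed_graph)
    (A : {set 'I_(order G) * 'I_(order G)}) : Prop :=
  optimal (edges G) (tree G) A.

(* Adjacency matrix, in row-major order.                                      *)
Definition matrix_code (n : nat) (f : rel 'I_n) : seq nat :=
  [seq nat_of_bool (f u v) | u <- enum 'I_n, v <- enum 'I_n].

Definition graph_code (G : mixed_graph) : seq nat :=
  [:: order G, nat_of_ord (root G)
    & matrix_code (fun u v => [set u; v] \in edges G)
      ++ matrix_code (arc (tree G))].

Definition solution_code (G : mixed_graph)
    (A : {set 'I_(order G) * 'I_(order G)}) : seq nat :=
  matrix_code (arc A).

(* Main.v *)
(* Arcs towards ancestors are harmless, so a feasible solution amounts to a    *)
(* linear order extending the tree, where a vertex is covered when it has a    *)
(* neighbour placed before it.  With two arms every ancestor-closed set        *)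
(* containing the root is the set of ancestors of a pair of vertices, so there *)
(* are only n^2 prefixes, and an optimal order is a heaviest chain of them:    *)
(* passing from S to S' covers the vertices of S' \ S with a neighbour in S.   *)
(* All stages (reachability, heaviest chains, trace of an optimal chain) are   *)
(* n-fold iterations of definitions of n x n arrays by bounded sums, maxima    *)
(* and tests; such definitions compile to loops running exactly n times, which *)
(* makes the time bound independent of the algorithm.                          *)

(* Upper bound. In an acyclic solution [B], a set of vertices closed under [T] and [B] can be
   enlarged one vertex at a time, always by a vertex whose arcs all lead into the set. On two arms
   every closed set containing the root is [ancestors s] for a pair [s] ([two_arms_ancestors]), so
   this growth is one of the chains over which [best] maximizes the total [gain]. Hence [B] covers
   at most [best (d, d)] vertices ([covered_le_best], [num_covered_le_best]).

   Lower bound. Any [next] whose steps are [good] traces a chain that attains [best]. Directing each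
   edge separated by a set of the chain into that set gives [chain_arcs], which is acyclic
   ([chain_arcs_acyclic]) and covers at least [best (d, d)] vertices ([best_le_num_covered]).
   Together these give [chain_arcs_optimal].

   Time. The recursions are written in a small array language. Every program of it compiles to loops
   of exactly n rounds, so its running time is polynomial by induction on syntax ([counted_exec],
   [program_in_poly_time]). What remains is semantic: [run_solver] identifies the output of [solver]
   with [chain_arcs] for some admissible [next]. *)
From mathcomp Require Import all_boot zify.
Require Import Defs.

Set Implicit Arguments.
Unset Strict Implicit.
Unset Printing Implicit Defensive.

(** * Counted loops *)

(* On loops this agrees with [exec] only when each iteration decrements the    *)
(* test, as in [For] below.                                                    *)
Fixpoint run (c : cmd) (s : state) : state :=
  match c with
  | Skip => s
  | Assign x e => State (update (reg s) x (eval s e)) (mem s)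
  | Store e1 e2 => State (reg s) (update (mem s) (eval s e1) (eval s e2))
  | Seq c1 c2 => run c2 (run c1 s)
  | If e c1 c2 => if eval s e != 0 then run c1 s else run c2 s
  | While e c => iter (eval s e) (run c) s
  end.

Fixpoint writes (c : cmd) : seq nat :=
  match c with
  | Skip | Store _ _ => [::]
  | Assign x _ => [:: x]
  | Seq c1 c2 | If _ c1 c2 => writes c1 ++ writes c2
  | While _ c => writes c
  end.

Fixpoint storeless (c : cmd) : bool :=
  match c with
  | Skip | Assign _ _ => true
  | Store _ _ => false
  | Seq c1 c2 | If _ c1 c2 => storeless c1 && storeless c2
  | While _ c => storeless c
  end.

Definition For (x : nat) (c : cmd) : cmd :=
  Seq (Assign x (Const 0))
    (While (Sub (Reg 0) (Reg x)) (Seq c (Assign x (Add (Reg x) (Const 1))))).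

(** Register 0 is never assigned, so it keeps the order of the graph and bounds every loop. *)
Inductive counted : cmd -> Prop :=
| counted_assign x e : x != 0 -> counted (Assign x e)
| counted_store e1 e2 : counted (Store e1 e2)
| counted_seq c1 c2 : counted c1 -> counted c2 -> counted (Seq c1 c2)
| counted_if e c1 c2 : counted c1 -> counted c2 -> counted (If e c1 c2)
| counted_for x c : x != 0 -> x \notin writes c -> counted c -> counted (For x c).

Lemma update_eq f x v : update f x v x = v.
Proof. by rewrite /update eqxx. Qed.

Lemma update_neq f x v y : y != x -> update f x v y = f y.
Proof. by rewrite /update => /negPf ->. Qed.

Ltac simpl_update :=
  repeat (rewrite update_eq || (rewrite update_neq; [|by lia])).

Lemma run_seq c1 c2 s : run (Seq c1 c2) s = run c2 (run c1 s).
Proof. by []. Qed.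

Lemma run_assign x e s :
  run (Assign x e) s = State (update (reg s) x (eval s e)) (mem s).
Proof. by []. Qed.

Lemma run_if e c1 c2 s :
  run (If e c1 c2) s = if eval s e != 0 then run c1 s else run c2 s.
Proof. by []. Qed.

Lemma run_unwritten c s x : x \notin writes c -> reg (run c s) x = reg s x.
Proof.
elim: c s => //= [y e|c1 IH1 c2 IH2|e c1 IH1 c2 IH2|e c IH] s.
- by rewrite inE /update => /negPf ->.
- by rewrite mem_cat negb_or => /andP[? ?]; rewrite IH2 ?IH1.
- by rewrite mem_cat negb_or => /andP[? ?]; case: ifP => _; rewrite ?IH1 ?IH2.
- by move=> xc; elim: (eval s e) => //= m <-; rewrite IH.
Qed.

Lemma run_storeless c s : storeless c -> mem (run c s) = mem s.
Proof.
elim: c s => //= [c1 IH1 c2 IH2|e c1 IH1 c2 IH2|e c IH] s.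
- by move=> /andP[? ?]; rewrite IH2 ?IH1.
- by move=> /andP[? ?]; case: ifP => _; rewrite ?IH1 ?IH2.
- by move=> sc; elim: (eval s e) => //= m <-; rewrite IH.
Qed.

Lemma counted_writes c : counted c -> 0 \notin writes c.
Proof.
elim=> //= [x e|c1 c2 _ H1 _ H2|e c1 c2 _ H1 _ H2|x c1 x0 _ _ IH].
- by rewrite inE eq_sym.
- by rewrite mem_cat negb_or H1.
- by rewrite mem_cat negb_or H1.
- by rewrite inE mem_cat inE !negb_or eq_sym x0 IH.
Qed.

(** Sequences and branches add coefficients and exponents; a loop raises the exponent by one. *)
Lemma counted_exec c : counted c -> exists a k, forall s,
  exists2 t, exec c s t (run c s) & t <= a * (reg s 0).+1 ^ k.
Proof.
move=> Cc; elim: c / Cc => [x e _|e1 e2|c1 c2 C1 [a1 [k1 H1]] _ [a2 [k2 H2]]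
  |e c1 c2 _ [a1 [k1 H1]] _ [a2 [k2 H2]]|x c1 x0 xc Cc1 [a [k H]]].
- by exists (ecost e).+1, 0 => s; exists (ecost e).+1; [constructor | rewrite muln1].
- exists (ecost e1 + ecost e2).+1, 0 => s; exists (ecost e1 + ecost e2).+1.
    by constructor.
  by rewrite muln1.
- exists (a1 + a2), (k1 + k2) => s.
  have [t1 E1 le1] := H1 s; have [t2 E2 le2] := H2 (run c1 s).
  exists (t1 + t2); first exact: exec_seq E1 E2.
  rewrite run_unwritten ?counted_writes // in le2.
  rewrite mulnDl leq_add //.
    by rewrite (leq_trans le1) // leq_mul2l leq_pexp2l ?leq_addr ?orbT.
  by rewrite (leq_trans le2) // leq_mul2l leq_pexp2l ?leq_addl ?orbT.
- exists (a1 + a2 + (ecost e).+1), (k1 + k2) => s; rewrite /=.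
  set X := _ ^ _; have X0 : 0 < X by rewrite expn_gt0.
  have [t1 E1 le1] := H1 s; have [t2 E2 le2] := H2 s.
  have {}le1 : t1 <= a1 * X.
    by rewrite (leq_trans le1) // leq_mul2l leq_pexp2l ?leq_addr ?orbT.
  have {}le2 : t2 <= a2 * X.
    by rewrite (leq_trans le2) // leq_mul2l leq_pexp2l ?leq_addl ?orbT.
  case: ifP => [e0|/negbFE/eqP e0].
    by exists (ecost e + t1).+1; [exact: exec_if_true | nia].
  by exists (ecost e + t2).+1; [exact: exec_if_false | nia].
- have c0 := counted_writes Cc1.
  (* With n = [reg s 0], the loop costs n times the body plus an overhead of 8 * n + 6: test and
     increment in each round, the initial assignment and the last failing test. *)
  exists (a + 20), k.+1 => s /=.
  set s0 := State _ _; set body := (X in iter _ X _).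
  have s00 : reg s0 0 = reg s 0 by rewrite /= /update eq_sym (negPf x0).
  have s0x : reg s0 x = 0 by rewrite /= /update eqxx.
  rewrite /update eq_sym (negPf x0) eqxx subn0.
  set n := reg s 0 in s00 *; set B := a * n.+1 ^ k.
  suff loop m s1 : reg s1 0 = n -> n - reg s1 x = m -> exists2 t,
      exec (While (Sub (Reg 0) (Reg x)) (Seq c1 (Assign x (Add (Reg x) (Const 1)))))
        s1 t (iter m body s1) & t <= m * (B + 8) + 4.
    have [t Et le_t] := loop n s0 s00 (etrans (congr1 _ s0x) (subn0 _)).
    exists (2 + t); first by apply: exec_seq Et; exact: exec_assign.
    have : 0 < n.+1 ^ k by rewrite expn_gt0.
    move: le_t; rewrite /B expnS; nia.
  elim: m s1 => [|m IH] s1 s10 s1x.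
    by exists 4; [apply: exec_while_false; rewrite /= s10 | lia].
  have [t Et] := H s1; rewrite s10 -/B => le_t.
  have [||t' Et' le_t'] := IH (body s1).
  + by rewrite /body /= /update eq_sym (negPf x0) run_unwritten.
  + by rewrite /body /= /update eqxx run_unwritten //; lia.
  exists (3 + (t + 4) + t').+1; last by lia.
  rewrite iterSr; apply: (exec_while_true (s2 := body s1)) => //.
    by rewrite /= s10 s1x.
  by apply: exec_seq Et _; exact: exec_assign.
Qed.

(** Invariant rule for loops; the index of [I] is the number of completed rounds. *)
Lemma run_for (x : nat) (c : cmd) (s : state) (I : nat -> state -> Prop) :
    x != 0 -> x \notin writes c -> 0 \notin writes c ->
    I 0 (State (update (reg s) x 0) (mem s)) ->
    (forall i s', i < reg s 0 -> reg s' 0 = reg s 0 -> reg s' x = i -> I i s' ->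
      I i.+1 (State (update (reg (run c s')) x i.+1) (mem (run c s')))) ->
  I (reg s 0) (run (For x c) s).
Proof.
move=> x0 xc c0 I0 IS /=; set s0 := State _ _; set body := (X in iter _ X _).
rewrite /update eq_sym (negPf x0) eqxx subn0.
have: reg s 0 <= reg s 0 by [].
suff inv m : m <= reg s 0 -> [/\ I m (iter m body s0),
    reg (iter m body s0) 0 = reg s 0 & reg (iter m body s0) x = m].
  by case/inv.
elim: m => [|m IH] le_m /=.
  by split; rewrite //= /update ?eqxx // eq_sym (negPf x0).
have [|Im m0 mx] := IH; first exact: ltnW.
split.
- by rewrite /body /= run_unwritten // mx addn1; apply: IS.
- by rewrite /body /= /update eq_sym (negPf x0) run_unwritten.
- by rewrite /body /= /update eqxx run_unwritten // mx addn1.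
Qed.

(** * A language of bounded sums over square arrays *)

(* Array k of order n is stored in row-major order from address 2 + k * n * n, *)
(* so that arrays 0 and 1 are the two matrices of the input.  Variable i is    *)
(* the i-th entry of the environment, and [BigSum] and [BigMax] append their   *)
(* bound variable to it.                                                      *)
Inductive term : Type :=
| Lit of nat
| Var of nat
| Cell of nat & term & term
| Plus of term & term
| Minus of term & term
| Cond of term & term & term
| BigSum of term
| BigMax of term.

Definition arrays := nat -> nat -> nat -> nat.

Fixpoint teval (n : nat) (a : arrays) (env : seq nat) (t : term) : nat :=
  match t with
  | Lit c => c
  | Var x => nth 0 env x
  | Cell k t1 t2 =>
      let u := teval n a env t1 in let v := teval n a env t2 in
      if (u < n) && (v < n) then a k u v else 0
  | Plus t1 t2 => teval n a env t1 + teval n a env t2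
  | Minus t1 t2 => teval n a env t1 - teval n a env t2
  | Cond t t1 t2 =>
      if teval n a env t != 0 then teval n a env t1 else teval n a env t2
  | BigSum t1 => \sum_(i < n) teval n a (rcons env i) t1
  | BigMax t1 => \max_(i < n) teval n a (rcons env i) t1
  end.

Fixpoint reads (t : term) : seq nat :=
  match t with
  | Lit _ | Var _ => [::]
  | Cell k t1 t2 => k :: reads t1 ++ reads t2
  | Plus t1 t2 | Minus t1 t2 => reads t1 ++ reads t2
  | Cond t t1 t2 => reads t ++ reads t1 ++ reads t2
  | BigSum t1 | BigMax t1 => reads t1
  end.

Definition cell (b n k u v : nat) : nat := b + v + n * (u + n * k).

(** The machine cannot multiply, so the products in [cell] arise from nested loops: each of the n
    outer rounds adds [x], and then [k] n times. *)
Definition address (b k x y q : nat) : cmd :=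
  Seq (Assign q (Add (Const b) (Reg y)))
    (For q.+1 (Seq (Assign q (Add (Reg q) (Reg x)))
      (For q.+2 (Assign q (Add (Reg q) (Const k)))))).

(* The value is left in register p, and no register below p changes; vs lists *)
(* the registers of the environment, and register 0 holds n.                  *)
Fixpoint comp (vs : seq nat) (p : nat) (t : term) : cmd :=
  match t with
  | Lit c => Assign p (Const c)
  | Var x => Assign p (nth (Const 0) [seq Reg v | v <- vs] x)
  | Cell k t1 t2 =>
      Seq (comp vs p t1) (Seq (comp vs p.+1 t2)
        (If (Sub (Reg 0) (Reg p))
          (If (Sub (Reg 0) (Reg p.+1))
            (Seq (address 2 k p p.+1 p.+2) (Assign p (Fetch (Reg p.+2))))
            (Assign p (Const 0)))
          (Assign p (Const 0))))
  | Plus t1 t2 =>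
      Seq (comp vs p t1) (Seq (comp vs p.+1 t2)
        (Assign p (Add (Reg p) (Reg p.+1))))
  | Minus t1 t2 =>
      Seq (comp vs p t1) (Seq (comp vs p.+1 t2)
        (Assign p (Sub (Reg p) (Reg p.+1))))
  | Cond t t1 t2 => Seq (comp vs p t) (If (Reg p) (comp vs p t1) (comp vs p t2))
  | BigSum t1 =>
      Seq (Assign p (Const 0))
        (For p.+1 (Seq (comp (rcons vs p.+1) p.+2 t1)
          (Assign p (Add (Reg p) (Reg p.+2)))))
  | BigMax t1 =>
      Seq (Assign p (Const 0))
        (For p.+1 (Seq (comp (rcons vs p.+1) p.+2 t1)
          (Assign p (Add (Reg p) (Sub (Reg p.+2) (Reg p))))))
  end.

Lemma address_writes b k x y q : all (leq q) (writes (address b k x y q)).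
Proof. by rewrite /= !leqnn !leqW. Qed.

Lemma comp_writes vs p t : all (leq p) (writes (comp vs p t)).
Proof.
have up q r s : q <= r -> all (leq r) s -> all (leq q) s.
  by move=> qr; apply: sub_all => i; apply: leq_trans.
elim: t vs p => /= [c|x|k t1 IH1 t2 IH2|t1 IH1 t2 IH2|t1 IH1 t2 IH2
  |t IH t1 IH1 t2 IH2|t1 IH1|t1 IH1] vs p;
  rewrite ?all_cat /= ?all_cat /= ?IH ?IH1 ?leqnn ?leqnSn ?IH2 //=.
- by rewrite (up p p.+1) //= !(leqW, leqnn).
- by rewrite (up p p.+1).
- by rewrite (up p p.+1).
- by rewrite (up p p.+2) // !leqW.
- by rewrite (up p p.+2) // !leqW.
Qed.

Lemma leq_notin p x s : all (leq p) s -> x < p -> x \notin s.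
Proof. by move=> /allP ps xp; apply/negP => /ps; rewrite leqNgt xp. Qed.

Lemma comp_storeless vs p t : storeless (comp vs p t).
Proof.
by elim: t vs p => //= *; repeat (apply/andP; split); auto.
Qed.

Lemma counted_address b k x y q : 0 < q -> counted (address b k x y q).
Proof.
move=> q0.
have q0' : q != 0 by rewrite -lt0n.
apply: counted_seq; first exact: counted_assign.
apply: counted_for; rewrite ?inE //= ?inE; first lia.
apply: counted_seq; first exact: counted_assign.
by apply: counted_for; rewrite ?inE //=; [lia | exact: counted_assign].
Qed.

Lemma counted_comp vs p t : 0 < p -> counted (comp vs p t).
Proof.
elim: t vs p => /= [c|x|k t1 IH1 t2 IH2|t1 IH1 t2 IH2|t1 IH1 t2 IH2
  |t IH t1 IH1 t2 IH2|t1 IH1|t1 IH1] vs p p0; have p0' := lt0n_neq0 p0.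
- exact: counted_assign.
- exact: counted_assign.
- apply: counted_seq; first exact: IH1.
  apply: counted_seq; first exact: IH2.
  apply: counted_if; last exact: counted_assign.
  apply: counted_if; last exact: counted_assign.
  by apply: counted_seq; [exact: counted_address | exact: counted_assign].
- apply: counted_seq; first exact: IH1.
  by apply: counted_seq; [exact: IH2 | exact: counted_assign].
- apply: counted_seq; first exact: IH1.
  by apply: counted_seq; [exact: IH2 | exact: counted_assign].
- by apply: counted_seq; [exact: IH | apply: counted_if; [exact: IH1 | exact: IH2]].
- apply: counted_seq; first exact: counted_assign.
  apply: counted_for => //.
    by rewrite /= mem_cat inE negb_or (leq_notin (comp_writes _ _ _)) //= gtn_eqF.
  by apply: counted_seq; [exact: IH1 | exact: counted_assign].
- apply: counted_seq; first exact: counted_assign.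
  apply: counted_for => //.
    by rewrite /= mem_cat inE negb_or (leq_notin (comp_writes _ _ _)) //= gtn_eqF.
  by apply: counted_seq; [exact: IH1 | exact: counted_assign].
Qed.

Lemma run_comp_reg vs p t s x : x < p -> reg (run (comp vs p t) s) x = reg s x.
Proof. by move=> xp; rewrite run_unwritten ?(leq_notin (comp_writes _ _ _)). Qed.

Lemma run_comp_mem vs p t s : mem (run (comp vs p t) s) = mem s.
Proof. by rewrite run_storeless ?comp_storeless. Qed.

Lemma run_address b k x y q s : 0 < q -> x < q -> y < q ->
  reg (run (address b k x y q) s) q = cell b (reg s 0) k (reg s x) (reg s y).
Proof.
move=> q0 xq yq; rewrite /address run_seq run_assign.
set s1 := State _ _.
have s10 : reg s1 0 = reg s 0 by rewrite /=; simpl_update.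
have s1x : reg s1 x = reg s x by rewrite /=; simpl_update.
pose I m s' := reg s' q = b + reg s y + m * (reg s x + reg s 0 * k) /\ reg s' x = reg s x.
set loop := For _ _.
suff: I (reg s1 0) (run loop s1) by rewrite s10 => -[-> _].
apply: run_for => [//|||| i s' _ s'0 s'i [s'q s'x]].
- by rewrite /= !inE; lia.
- by rewrite /= !inE; lia.
- by rewrite /I /=; simpl_update; rewrite addn0.
rewrite run_seq run_assign; set loop' := For _ _; set s2 := (X in run loop' X).
pose J m s'' := reg s'' q = reg s' q + reg s' x + m * k /\ reg s'' x = reg s' x.
suff: J (reg s2 0) (run loop' s2).
  rewrite [reg s2 0]update_neq ?s'0 ?s10; last lia.
  by move: (run loop' s2) => s3 [Jq Jx]; rewrite /I /=; simpl_update; rewrite Jq Jx s'q s'x; lia.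
apply: run_for => [//|||| j s3 _ s30 s3j [s3q s3x]].
- by rewrite /= !inE; lia.
- by rewrite /= !inE; lia.
- by rewrite /J /=; simpl_update; rewrite addn0.
by rewrite run_assign /J /=; simpl_update; rewrite s3q s3x; lia.
Qed.

(** Restricting to the arrays in [ks] leaves out an array that is just being overwritten. *)
Definition represents (n : nat) (ks : nat -> bool) (m : nat -> nat) (a : arrays) :=
  forall k u v, ks k -> u < n -> v < n -> m (cell 2 n k u v) = a k u v.

Lemma represents_sub n (ks ks' : nat -> bool) m a :
  (forall k, ks k -> ks' k) -> represents n ks' m a -> represents n ks m a.
Proof. by move=> sub H k u v /sub; apply: H. Qed.

(** Shared by sums and maxima: [e] realizes [op], where the maximum of x and y is x + (y - x) with
    truncated subtraction. *)
Lemma run_big (op : Monoid.law 0) e (F : nat -> nat) vs p t s :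
    0 < p -> all (gtn p) vs ->
    (forall s', eval s' e = op (reg s' p) (reg s' p.+2)) ->
    (forall i s', mem s' = mem s -> reg s' 0 = reg s 0 ->
      map (reg s') (rcons vs p.+1) = rcons (map (reg s) vs) i ->
      reg (run (comp (rcons vs p.+1) p.+2 t) s') p.+2 = F i) ->
  reg (run (Seq (Assign p (Const 0))
    (For p.+1 (Seq (comp (rcons vs p.+1) p.+2 t) (Assign p e)))) s) p =
  \big[op/0]_(i < reg s 0) F i.
Proof.
move=> p0 ltv ee eF; rewrite run_seq run_assign; set s1 := State _ _.
have s10 : reg s1 0 = reg s 0 by rewrite /=; simpl_update.
pose I m s' := [/\ reg s' p = \big[op/0]_(i < m) F i,
  mem s' = mem s & map (reg s') vs = map (reg s) vs].
set loop := For _ _.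
suff: I (reg s1 0) (run loop s1) by rewrite s10 => -[].
have cw := comp_writes (rcons vs p.+1) p.+2 t.
apply: run_for => [//|||| i s' _ s'0 s'i [s'p s'm s'v]].
- by rewrite /= mem_cat inE (negPf (leq_notin cw _)) //=; lia.
- by rewrite /= mem_cat inE (negPf (leq_notin cw _)) //=; lia.
- split=> //=; first by simpl_update; rewrite big_ord0.
  by apply/eq_in_map => v /(allP ltv) /= vp; simpl_update.
have val := eF i s' s'm (etrans s'0 s10).
rewrite map_rcons s'v s'i in val.
rewrite run_seq run_assign; set s2 := run (comp _ _ _) s' in val *.
split.
- rewrite [LHS]/= update_neq; last by lia.
  by rewrite update_eq ee val // (run_comp_reg _ _ _ (leqW (leqnn _))) s'p big_ord_recr.
- by rewrite [LHS]run_comp_mem.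
- rewrite -s'v; apply/eq_in_map => v /(allP ltv) /= vp; simpl_update.
  by rewrite run_comp_reg //; lia.
Qed.

Lemma run_comp n a vs p t s : 0 < p -> all (gtn p) vs -> reg s 0 = n ->
  represents n [in reads t] (mem s) a ->
  reg (run (comp vs p t) s) p = teval n a (map (reg s) vs) t.
Proof.
(* Code compiled at level [q] writes only registers from [q] on, so the environment below
   survives. *)
have frame vs' p' q t' s' : p' <= q -> all (gtn p') vs' ->
    map (reg (run (comp vs' q t') s')) vs' = map (reg s') vs'.
  move=> pq /allP ltv; apply/eq_in_map => v /ltv /= vp.
  by rewrite run_comp_reg // (leq_trans vp).
have weak q r vs' : q <= r -> all (gtn q) vs' -> all (gtn r) vs'.
  by move=> qr; apply: sub_all => v /= /leq_trans; apply.
have subl ks1 ks2 m : represents n [in ks1 ++ ks2] m a -> represents n [in ks1] m a.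
  by apply: represents_sub => k; rewrite /= mem_cat => ->.
have subr ks1 ks2 m : represents n [in ks1 ++ ks2] m a -> represents n [in ks2] m a.
  by apply: represents_sub => k; rewrite /= mem_cat orbC => ->.
elim: t vs p s => [c|x|k t1 IH1 t2 IH2|t1 IH1 t2 IH2|t1 IH1 t2 IH2
  |t IH t1 IH1 t2 IH2|t1 IH1|t1 IH1] vs p s p0 ltv s0 rep.
- by rewrite /= /update eqxx.
- rewrite /= /update eqxx; elim: vs x {ltv rep} => [|v vs IHv] [|x] //=.
- rewrite [comp _ _ _]/= 2!run_seq.
  set s1 := run _ s; set s2 := run _ s1.
  have rep12 : represents n [in reads t1 ++ reads t2] (mem s) a.
    by apply: represents_sub rep => k' /= k'in; rewrite !inE k'in orbT.
  have s1p : reg s1 p = teval n a (map (reg s) vs) t1 by apply: IH1 => //; apply: subl rep12.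
  have s2p : reg s2 p = teval n a (map (reg s) vs) t1 by rewrite run_comp_reg.
  have s2q : reg s2 p.+1 = teval n a (map (reg s) vs) t2.
    rewrite IH2 // ?(frame _ p) ?run_comp_reg ?run_comp_mem //; [exact: weak ltv | exact: subr rep12].
  have s20 : reg s2 0 = n by rewrite !run_comp_reg.
  have s2m : mem s2 = mem s by rewrite !run_comp_mem.
  rewrite !run_if [eval _ _]/= s20 s2p; rewrite [eval _ _]/= s20 s2q -!lt0n !subn_gt0.
  rewrite [teval _ _ _ (Cell _ _ _)]/=.
  case: ltnP => lt1; last by rewrite /= update_eq.
  case: ltnP => lt2; last by rewrite /= update_eq.
  have := @run_address 2 k p p.+1 p.+2 s2 isT (leqnSn _) (leqnn _).
  have := @run_storeless (address 2 k p p.+1 p.+2) s2 isT.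
  rewrite run_seq run_assign s20 s2p s2q s2m; move: (run _ s2) => s3 s3m s3q.
  by rewrite /= update_eq s3m s3q rep ?inE ?eqxx.
- rewrite /= update_eq run_comp_reg // IH1 //; last exact: subl rep.
  rewrite IH2 ?(frame _ p) ?run_comp_reg ?run_comp_mem //; [exact: weak ltv | exact: subr rep].
- rewrite /= update_eq run_comp_reg // IH1 //; last exact: subl rep.
  rewrite IH2 ?(frame _ p) ?run_comp_reg ?run_comp_mem //; [exact: weak ltv | exact: subr rep].
- have rep12 := subr _ _ _ rep.
  rewrite [run _ _]/= IH //=; last exact: subl rep.
  by case: ifP => _; [rewrite IH1 | rewrite IH2];
    rewrite ?(frame _ p) ?run_comp_reg ?run_comp_mem //; [exact: subl rep12 | exact: subr rep12].
- pose F i := teval n a (rcons (map (reg s) vs) i) t1.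
  have -> : teval n a (map (reg s) vs) (BigSum t1) = \sum_(i < reg s 0) F i by rewrite s0.
  apply: (@run_big addn _ F) => // i s' s'm s'0 s'e.
  by rewrite IH1 ?s'0 ?s'm ?s'e // all_rcons /= leqnn (weak p) // !leqW.
- pose F i := teval n a (rcons (map (reg s) vs) i) t1.
  have -> : teval n a (map (reg s) vs) (BigMax t1) = \max_(i < reg s 0) F i by rewrite s0.
  apply: (@run_big maxn _ F) => // [s'|i s' s'm s'0 s'e]; first by rewrite /= maxnE.
  by rewrite IH1 ?s'0 ?s'm ?s'e // all_rcons /= leqnn (weak p) // !leqW.
Qed.

(** Registers [p] and [p.+1] count rows and columns, [p.+2] receives the value and [p.+3] the
    address. Register 1 holds the root, which thus becomes variable 0. *)
Definition table (b k p : nat) (t : term) : cmd :=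
  For p (For p.+1 (Seq (comp [:: 1; p; p.+1] p.+2 t)
    (Seq (address b k p p.+1 p.+3) (Store (Reg p.+3) (Reg p.+2))))).

Lemma table_writes b k p t : all (leq p) (writes (table b k p t)).
Proof.
have := comp_writes [:: 1; p; p.+1] p.+2 t; rewrite /= !all_cat /= => cw.
rewrite (sub_all _ cw) => [|i]; last by rewrite /=; lia.
by rewrite !andbT; lia.
Qed.

Lemma counted_table b k p t : 0 < p -> counted (table b k p t).
Proof.
move=> p0; have cw := comp_writes [:: 1; p; p.+1] p.+2 t.
apply: counted_for; first by rewrite -lt0n.
  by rewrite /= !(inE, mem_cat) !(negPf (leq_notin cw _)) //=; lia.
apply: counted_for => //.
  by rewrite /= !(inE, mem_cat) !(negPf (leq_notin cw _)) //=; lia.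
apply: counted_seq; first exact: counted_comp.
by apply: counted_seq; [exact: counted_address | exact: counted_store].
Qed.

(** Beyond the offset [b], [cell] is an expansion in base [n] with digits [v] and [u] and leading
    part [k]. *)
Lemma cell_inj b n k u v k' u' v' : u < n -> v < n -> u' < n -> v' < n ->
  cell b n k u v = cell b n k' u' v' -> [/\ k = k', u = u' & v = v'].
Proof.
rewrite /cell => ltu ltv ltu' ltv' /eqP; rewrite -!addnA eqn_add2l => /eqP.
have n0 : 0 < n by case: (n) ltu.
rewrite ![_ + n * _]addnC ![n * _]mulnC => eq.
have := congr1 (modn^~ n) eq; rewrite /= !modnMDl !modn_small // => ->.
have := congr1 (divn^~ n) eq; rewrite /= !divnMDl // !divn_small // !addn0 => {}eq.
have := congr1 (modn^~ n) eq; rewrite /= !modnMDl !modn_small // => ->.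
by have := congr1 (divn^~ n) eq; rewrite /= !divnMDl // !divn_small // !addn0.
Qed.

(** The arrays in [ks] are disjoint from the written cells and [t] reads no others, so each entry is
    computed from the initial contents. *)
Lemma run_table (b k p : nat) (t : term) (n : nat) (a : arrays) (ks : nat -> bool) s :
    1 < p -> reg s 0 = n -> represents n ks (mem s) a ->
    (forall k', k' \in reads t -> ks k') ->
    (forall k' u v u' v', ks k' -> u < n -> v < n -> u' < n -> v' < n ->
      cell b n k u v <> cell 2 n k' u' v') ->
  let s' := run (table b k p t) s in
  represents n ks (mem s') a /\ forall u v, u < n -> v < n ->
    mem s' (cell b n k u v) = teval n a [:: reg s 1; u; v] t.
Proof.
move=> p1 s0 rep sub disj.
pose f u v := teval n a [:: reg s 1; u; v] t.
pose I i s' := [/\ represents n ks (mem s') a, reg s' 1 = reg s 1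
  & forall u v, u < i -> v < n -> mem s' (cell b n k u v) = f u v].
suff: I (reg s 0) (run (table b k p t) s) by rewrite s0 => -[].
have cw := comp_writes [:: 1; p; p.+1] p.+2 t.
apply: run_for => [|||| i s1 lti s10 s1i [rep1 s11 s1f]]; first lia.
- by rewrite /= !(inE, mem_cat) !(negPf (leq_notin cw _)) //=; lia.
- by rewrite /= !(inE, mem_cat) !(negPf (leq_notin cw _)) //=; lia.
- by split=> //=; simpl_update.
rewrite s0 in lti.
pose J j s' := [/\ represents n ks (mem s') a, reg s' 1 = reg s 1, reg s' p = i,
  (forall u v, u < i -> v < n -> mem s' (cell b n k u v) = f u v)
  & forall v, v < j -> mem s' (cell b n k i v) = f i v].
set loop := For _ _; suff: J (reg s1 0) (run loop s1).
  rewrite s10 s0; move: (run loop s1) => s2 [rep2 s21 s2p s2f s2g].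
  split=> //=; first by simpl_update.
  by move=> u v; rewrite ltnS leq_eqVlt => /orP[/eqP->|?] ?; [apply: s2g | apply: s2f].
apply: run_for => [//|||| j s2 ltj s20 s2j [rep2 s21 s2p s2f s2g]].
- by rewrite /= !(inE, mem_cat) !(negPf (leq_notin cw _)) //=; lia.
- by rewrite /= !(inE, mem_cat) !(negPf (leq_notin cw _)) //=; lia.
- by split=> //=; simpl_update.
rewrite s10 s0 in ltj; rewrite s10 s0 in s20.
rewrite 2!run_seq.
have ltv : all (gtn p.+2) [:: 1; p; p.+1] by rewrite /= !andbT; lia.
have := @run_comp n a [:: 1; p; p.+1] p.+2 t s2 isT ltv s20 (represents_sub sub rep2).
rewrite [map _ _]/= s21 s2p s2j -/(f i j).
have s3r x : x < p.+2 -> reg (run (comp [:: 1; p; p.+1] p.+2 t) s2) x = reg s2 x.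
  exact: run_comp_reg.
have := run_comp_mem [:: 1; p; p.+1] p.+2 t s2.
move: (run _ s2) s3r => s3 s3r s3m s3v.
have s3p : reg s3 p = i by rewrite s3r ?s2p //; lia.
have s3q : reg s3 p.+1 = j by rewrite s3r ?s2j.
have s30 : reg s3 0 = n by rewrite s3r ?s20.
have := @run_address b k p p.+1 p.+3 s3 isT (leqW (leqnSn _)) (leqnSn _).
rewrite s3p s3q s30.
have aw := address_writes b k p p.+1 p.+3.
have s4r x : x < p.+3 -> reg (run (address b k p p.+1 p.+3) s3) x = reg s3 x.
  by move=> ltx; rewrite run_unwritten ?(leq_notin aw).
have := @run_storeless (address b k p p.+1 p.+3) s3 isT.
move: (run _ s3) s4r => s4 s4r s4m s4a.
have s4v : reg s4 p.+2 = f i j by rewrite s4r.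
have s41 : reg s4 1 = reg s 1 by rewrite s4r ?s3r //; lia.
have s4p : reg s4 p = i by rewrite s4r ?s3p //; lia.
rewrite /= s4a s4v s4m s3m; split=> /=.
- move=> k' u v k's ltu ltv'; rewrite update_neq ?rep2 //.
  by apply/eqP => /esym; apply: disj.
- by simpl_update.
- by simpl_update.
- move=> u v ltu ltv'; rewrite update_neq ?s2f //; apply/eqP => /cell_inj[] //; lia.
- move=> v; rewrite ltnS leq_eqVlt => /orP[/eqP->|ltvj]; first by rewrite update_eq.
  by rewrite update_neq ?s2g //; apply/eqP => /cell_inj[] //; lia.
Qed.

(** * Programs of array definitions and their compilation *)

Inductive program : Type :=
| Define of nat & term
| Then of program & program
| Repeat of program.

Fixpoint prun (n d : nat) (c : program) (a : arrays) : arrays :=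
  match c with
  | Define k t =>
      fun k' u v => if k' == k then teval n a [:: d; u; v] t else a k' u v
  | Then c1 c2 => prun n d c2 (prun n d c1 a)
  | Repeat c1 => iter n (prun n d c1) a
  end.

(** [prun] evaluates a definition in the old arrays, while the compiled table overwrites its array
    entry by entry; the two agree if the array is not read meanwhile. *)
Fixpoint not_self_reading (c : program) : bool :=
  match c with
  | Define k t => k \notin reads t
  | Then c1 c2 => not_self_reading c1 && not_self_reading c2
  | Repeat c1 => not_self_reading c1
  end.

Fixpoint pcomp (p : nat) (c : program) : cmd :=
  match c with
  | Define k t => table 2 k p t
  | Then c1 c2 => Seq (pcomp p c1) (pcomp p c2)
  | Repeat c1 => For p (pcomp p.+1 c1)
  end.

Lemma pcomp_writes p c : all (leq p) (writes (pcomp p c)).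
Proof.
elim: c p => [k t|c1 IH1 c2 IH2|c IH] p; first exact: table_writes.
  by rewrite /= all_cat IH1 IH2.
rewrite /= all_cat /= leqnn /= andbT; apply: sub_all (IH p.+1) => i; exact: ltnW.
Qed.

Lemma counted_pcomp p c : 0 < p -> counted (pcomp p c).
Proof.
elim: c p => [k t|c1 IH1 c2 IH2|c IH] p p0; first exact: counted_table.
  by apply: counted_seq; [apply: IH1 | apply: IH2].
apply: counted_for; [by rewrite -lt0n | exact: leq_notin (pcomp_writes _ _) _ | exact: IH].
Qed.

Lemma run_pcomp n d p c a s : 1 < p -> not_self_reading c ->
  reg s 0 = n -> reg s 1 = d -> represents n xpredT (mem s) a ->
  represents n xpredT (mem (run (pcomp p c) s)) (prun n d c a).
Proof.
elim: c p a s => [k t|c1 IH1 c2 IH2|c IH] p a s p1 nsr s0 s1 rep.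
- have [|||rep' val] := @run_table 2 k p t n a (fun k' => k' != k) s p1 s0.
  + by apply: represents_sub rep.
  + by move=> k' k't; apply: contraNneq nsr => <-.
  + by move=> k' u v u' v' k'k * /cell_inj[] // k_k'; rewrite k_k' eqxx in k'k.
  move=> k' u v _ ltu ltv /=; case: eqP => [->|/eqP k'k].
    by rewrite val // s1.
  by rewrite rep'.
- case/andP: nsr => nsr1 nsr2.
  rewrite /=; apply: IH2; rewrite ?run_unwritten ?(leq_notin (pcomp_writes _ _)) //; try lia.
  exact: IH1.
- pose I i s' := reg s' 1 = d /\ represents n xpredT (mem s') (iter i (prun n d c) a).
  suff: I (reg s 0) (run (For p (pcomp p.+1 c)) s) by rewrite s0 => -[].
  have cw := pcomp_writes p.+1 c.
  apply: run_for => [|||| i s' lti s'0 s'i [s'1 rep']]; rewrite ?(leq_notin cw) //; try lia.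
  + by rewrite /I /=; simpl_update.
  + split; last by apply: IH; rewrite // ?s'0 //; lia.
    by rewrite /=; simpl_update; rewrite run_unwritten // (leq_notin cw) //; lia.
Qed.

(** The machine loads the order and the root into registers 0 and 1, runs the compiled program and
    copies array [out] to the beginning of the memory. *)
Lemma program_in_poly_time (c : program) (out : nat) :
  not_self_reading c -> 0 < out ->
  exists prog a k, forall w : seq nat,
    let n := nth 0 w 0 in let d := nth 0 w 1 in
    exists t s, [/\ exec prog (init w) t s, t <= a * n.+1 ^ k + a &
      forall u v, u < n -> v < n -> mem s (u * n + v) =
        prun n d c (fun k u v => nth 0 w (cell 2 n k u v)) out u v].
Proof.
move=> nsr out0.
set c1 := Seq (pcomp 2 c) (table 0 0 2 (Cell out (Var 1) (Var 2))).
have [|a [k H]] := @counted_exec c1.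
  by apply: counted_seq; [exact: counted_pcomp | exact: counted_table].
exists (Seq (Assign 0 (Fetch (Const 0))) (Seq (Assign 1 (Fetch (Const 1))) c1)).
(* Each of the two initial loads costs 3 steps. *)
exists (a + 6), k => w n d.
pose s1 := State (update (fun=> 0) 0 n) (nth 0 w).
pose s2 := State (update (reg s1) 1 d) (nth 0 w).
have [t Et le_t] := H s2.
exists (3 + (3 + t)), (run c1 s2); split.
- apply: (exec_seq (s2 := s1)); first exact: exec_assign.
  by apply: exec_seq Et; exact: exec_assign.
- have {}le_t : t <= a * n.+1 ^ k := le_t.
  by move: (n.+1 ^ k) le_t => X; nia.
move=> u v ltu ltv; rewrite run_seq.
set a0 := fun k => _.
have s20 : reg s2 0 = n by [].
have rep : represents n xpredT (mem s2) a0 by [].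
have rep3 := @run_pcomp n d 2 c a0 s2 isT nsr s20 erefl rep.
set s3 := run (pcomp 2 c) s2 in rep3 *.
have s30 : reg s3 0 = n.
  by rewrite run_unwritten // (leq_notin (pcomp_writes _ _)).
(* The output occupies the first n * n addresses, while an array with index [k' != 0] starts at
   address 2 + n * n or later; so array [out] stays intact during the copy. *)
have [|||_ val] := @run_table 0 0 2 (Cell out (Var 1) (Var 2)) n
    (prun n d c a0) (fun k' => k' != 0) s3 isT s30.
- exact: represents_sub rep3.
- by move=> k'; rewrite !inE => /eqP ->; rewrite -lt0n.
- by move=> k' x y x' y'; rewrite -lt0n /cell => k'0 ltx lty _ _; nia.
rewrite (_ : u * n + v = cell 0 n 0 u v); last by rewrite /cell; lia.
rewrite [LHS]val //; move: (prun n d c a0) (reg s3 1) => a3 e.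
by rewrite /= ltu ltv.
Qed.

(** * Chains of ancestor-closed sets *)

Lemma acyclic_of_rank (V : finType) (A : {set V * V}) (f : V -> nat) :
  (forall u v, (u, v) \in A -> f v < f u) -> acyclic A.
Proof.
move=> lt_f [//|x s] _; apply/negP => /=.
have sub y p : path (arc A) y p -> path (fun u v => f v < f u) y p.
  by apply: sub_path => u v /lt_f.
have tr : transitive (fun u v => f v < f u).
  by move=> v u w /= uv vw; apply: ltn_trans vw uv.
move/sub; rewrite path_sortedE // => /andP[/allP lt_x _].
by have := lt_x x; rewrite mem_rcons mem_head ltnn => /(_ isT).
Qed.

(** Take [v] in [X] reaching the fewest vertices. An arc from [v] to a [w] in [X] would make [w]
    reach strictly fewer, since [w] cannot reach [v] back. *)
Lemma acyclic_min (V : finType) (A : {set V * V}) (X : {set V}) :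
  acyclic A -> X != set0 ->
  exists2 v, v \in X & forall w, (v, w) \in A -> w \notin X.
Proof.
move=> acA /set0Pn[v0 v0X].
pose c v := #|[set w | connect (arc A) v w]|.
case: (@arg_minnP V v0 [in X] c v0X) => v vX minv.
exists v => // w vw; apply/negP => wX.
have cvw : connect (arc A) v w by exact: connect1.
have [/connectP[p wp lp]|nwv] := boolP (connect (arc A) w v).
  by have := acA (v :: belast w p) isT; rewrite /= [in rcons _ v]lp -lastI /= wp andbT => /negP.
have := minv w wX; rewrite leqNgt => /negP[]; apply: proper_card.
apply/properP; split; last by exists v; rewrite !inE ?connect0.
by apply/subsetP => y; rewrite !inE; apply: connect_trans.
Qed.

Lemma path_arcs_path (V : finType) (A : {set V * V}) (v : V) (p : seq V) :
  {subset path_arcs (v :: p) <= A} -> path (arc A) v p.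
Proof.
elim: p v => //= w p IH v sub; rewrite /arc /= sub ?mem_head // IH // => a ap.
by apply: sub; rewrite inE ap orbT.
Qed.

Section Chains.

Variables (V : finType) (E : {set {set V}}) (T : {set V * V}) (d : V).
Implicit Types (s : V * V) (S : {set V}) (A B : {set V * V}).

(** A vertex counts as its own ancestor; [locked] keeps the set from being unfolded by
    simplification. *)
Definition ancestors s : {set V} :=
  locked [set x | connect (arc T) s.1 x || connect (arc T) s.2 x].

Lemma in_ancestors s x :
  (x \in ancestors s) = connect (arc T) s.1 x || connect (arc T) s.2 x.
Proof. by rewrite /ancestors -lock inE. Qed.

Definition gain s s' : nat :=
  #|[set v | [&& v \in ancestors s', v \notin ancestors s
    & [exists x, (x \in ancestors s) && ([set v; x] \in E)]]]|.

Definition improve (g : V * V -> nat) s : nat :=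
  \max_(s' | ancestors s \proper ancestors s') (gain s s' + g s').

Definition best : V * V -> nat := iter #|V| improve (fun=> 0).

Lemma ancestors_self1 s : s.1 \in ancestors s.
Proof. by rewrite in_ancestors connect0. Qed.

Lemma ancestors_closed s u v :
  u \in ancestors s -> (u, v) \in T -> v \in ancestors s.
Proof.
rewrite !in_ancestors => su uv; have {}uv : connect (arc T) u v by exact: connect1.
by case/orP: su => su; rewrite (connect_trans su uv) ?orbT.
Qed.

(** If only k vertices are missing from [ancestors s], a strict chain from there has at most k
    steps, so a further round changes nothing. With k = [#|V|] this makes [best] a fixed point. *)
Lemma iter_improve_stable k s :
  #|V| <= k + #|ancestors s| ->
  iter k.+1 improve (fun=> 0) s = iter k improve (fun=> 0) s.
Proof.
elim: k s => [|k IH] s le_k.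
  rewrite /= /improve big_pred0 // => s'; apply/negP => /proper_card.
  by rewrite ltnNge (leq_trans (max_card _) le_k).
rewrite iterS [in RHS]iterS /improve; apply: eq_bigr => s' /proper_card lt_s.
by congr (_ + _); apply: IH; lia.
Qed.

Lemma bestE s : best s = improve best s.
Proof. by rewrite -[LHS](@iter_improve_stable #|V|) ?leq_addr. Qed.

(** Standing still is allowed once nothing is left to gain; so every state has a good successor and
    [next] can be total. *)
Definition good s s' : bool :=
  [&& ancestors s \subset ancestors s', best s <= gain s s' + best s'
    & (best s == 0) || (ancestors s \proper ancestors s')].

Lemma good_exists s : exists s', good s s'.
Proof.
have [b0|b_gt0] := posnP (best s).
  by exists s; rewrite /good subxx b0.
have [|] := boolP [exists s', ancestors s \proper ancestors s'].
  move=> /existsP[s1 ps1].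
  have := bestE s; rewrite /improve (bigmax_eq_arg s1) //.
  case: arg_maxnP => // s' ps' _ eq_s.
  by exists s'; rewrite /good proper_sub //= eq_s leqnn ps' orbT.
rewrite negb_exists => /forallP nps.
by move: b_gt0; rewrite bestE /improve big_pred0 // => s'; apply/negbTE.
Qed.

(** * The solution read off a heaviest chain, and its optimality *)

Variable next : V * V -> V * V.
Hypothesis next_good : forall s, good s (next s).

Let chain k := iter k next (d, d).

Definition chain_arcs (n : nat) : {set V * V} :=
  [set a | ([set a.1; a.2] \in E) && [exists k : 'I_n,
    (a.2 \in ancestors (chain k)) && (a.1 \notin ancestors (chain k))]].

Lemma chain_arcsP n u v : reflect
  ([set u; v] \in E /\
    exists k, [/\ k < n, v \in ancestors (chain k) & u \notin ancestors (chain k)])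
  ((u, v) \in chain_arcs n).
Proof.
rewrite inE /=; apply: (iffP andP) => -[uvE].
  by move=> /existsP[k /andP[vk uk]]; split=> //; exists k.
by move=> [k [ltk vk uk]]; split=> //; apply/existsP; exists (Ordinal ltk); rewrite vk.
Qed.

Lemma chain_sub j k : j <= k -> ancestors (chain j) \subset ancestors (chain k).
Proof.
move=> /subnK <-; elim: (k - j) => // i IH.
by rewrite addSn; apply: subset_trans IH _; case/and3P: (next_good (chain (i + j))).
Qed.

(** The sets of the chain are nested, so no two of them separate an edge in opposite directions. *)
Lemma chain_arcs_oriented n : orientation_of_subset E (chain_arcs n).
Proof.
move=> u v /chain_arcsP[uvE [k [_ vk uk]]]; split=> //.
apply/chain_arcsP => -[_ [j [_ uj vj]]].
case: (leqP j k) => [|/ltnW] /chain_sub/subsetP sub.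
  by rewrite (sub _ uj) in uk.
by rewrite (sub _ vk) in vj.
Qed.

(* Arcs of T weakly decrease, and chosen arcs strictly decrease, the number of *)
(* sets in the chain that miss a vertex; T itself decreases the depth.         *)
Lemma chain_arcs_acyclic n : spanning_in_tree T d -> acyclic (T :|: chain_arcs n).
Proof.
move=> treeT.
have exw v : exists p, path (arc T) v p && (last v p == d).
  by have [p [[pp lp] _]] := treeT v; exists p; rewrite pp lp eqxx.
pose h v := size (xchoose (exw v)).
have hT u v : (u, v) \in T -> h u = (h v).+1.
  move=> uv; have [p [_ uniqp]] := treeT u.
  have /andP[pu /eqP lu] := xchooseP (exw u).
  have /andP[pv /eqP lv] := xchooseP (exw v).
  have eu := uniqp _ (conj pu lu).
  have := uniqp (v :: xchoose (exw v)); rewrite /= pv lv /arc /= uv => /(_ (conj isT erefl)).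
  by rewrite /h eu => ->.
pose M := \max_v h v.
pose r v := \sum_(k < n) (v \notin ancestors (chain k)).
(* The factor [M.+1] exceeds every depth, so this rank orders pairs ([r], [h]) lexicographically. *)
apply: (@acyclic_of_rank _ _ (fun v => r v * M.+1 + h v)) => u v.
have hM x : h x <= M by exact: leq_bigmax.
rewrite inE => /orP[uv|/chain_arcsP[_ [k [ltk vk uk]]]].
  have le_r : r v <= r u.
    apply: leq_sum => k _; case: (boolP (u \in _)) => [uk|_]; last by case: (_ \in _).
    by rewrite (ancestors_closed uk uv).
  by rewrite (hT _ _ uv) addnS ltnS leq_add2r leq_mul2r le_r orbT.
have lt_r : r v < r u.
  rewrite /r (bigD1 (Ordinal ltk)) //= [X in _ < X](bigD1 (Ordinal ltk)) //= vk uk.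
  rewrite add0n add1n ltnS; apply: leq_sum => j _.
  case: (boolP (u \in _)) => [uj|_]; last by case: (_ \in _).
  suff -> : v \in ancestors (chain j) by [].
  case: (leqP k j) => [|/ltnW] /chain_sub/subsetP sub; first exact: sub.
  by rewrite (sub _ uj) in uk.
have := hM v; have := leq_mul2r M.+1 (r v).+1 (r u); rewrite lt_r orbT mulSn; lia.
Qed.

(** Potential argument: in one step [best] drops by at most the gain, and each vertex counted by the
    gain is new and has an arc into the previous set of the chain. *)
Lemma best_le_covered n k : k <= n ->
  best (d, d) <= best (chain k) +
    #|[set u in ancestors (chain k) | covered (chain_arcs n) u]|.
Proof.
elim: k => [_|k IH lt_k]; first exact: leq_addr.
apply: leq_trans (IH (ltnW lt_k)) _.
have /and3P[/subsetP sub le_best _] := next_good (chain k).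
rewrite -[chain k.+1]/(next (chain k)).
apply: leq_trans (leq_add le_best (leqnn _)) _.
(* The gained vertices lie outside the old set, so the two counted sets are disjoint and their sizes
   add up. *)
rewrite addnAC addnC leq_add2l -cardsUI [X in _ + X](_ : _ = 0) ?addn0; last first.
  apply/eqP; rewrite cards_eq0 -subset0; apply/subsetP => u; rewrite in_setI => /andP[].
  by rewrite in_set => /and3P[_ /negPf us _]; rewrite in_set us.
apply: subset_leq_card; apply/subsetP => u; rewrite !in_setU !in_set.
case/orP=> [/and3P[su nu /existsP[x /andP[xk uxE]]]|/andP[uk ->]].
  rewrite su /=; apply/existsP; exists x; apply/chain_arcsP; split=> //.
  by exists k.
by rewrite sub.
Qed.

(** While [best] is positive the sets grow strictly, which for k = [#|V|] rules out the second
    alternative. *)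
Lemma chain_saturated k :
  (exists2 j, j <= k & best (chain j) = 0) \/ k < #|ancestors (chain k)|.
Proof.
elim: k => [|k [[j le_j bj]|lt_k]].
- by right; apply/card_gt0P; exists d; exact: (ancestors_self1 (d, d)).
- by left; exists j => //; apply: leqW.
have /and3P[_ _ /orP[/eqP b0|/proper_card lt_s]] := next_good (chain k).
  by left; exists k.
by right; apply: leq_ltn_trans lt_k lt_s.
Qed.

Lemma best_le_num_covered : best (d, d) <= num_covered (chain_arcs #|V|).
Proof.
have [[j le_j bj]|] := chain_saturated #|V|; last by rewrite ltnNge max_card.
apply: leq_trans (best_le_covered le_j) _; rewrite bj add0n.
by apply/subset_leq_card/subsetP => u; rewrite !in_set => /andP[].
Qed.

Hypothesis treeT : spanning_in_tree T d.

Lemma connect_root v : connect (arc T) v d.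
Proof. by have [p [[pp lp] _]] := treeT v; apply/connectP; exists p. Qed.

(** The tree path from [v] back to the root would close a cycle. *)
Lemma root_no_arc B v : acyclic (T :|: B) -> (d, v) \notin T :|: B.
Proof.
move=> acTB; apply/negP => dv.
have /connectP[p vp lp] : connect (arc (T :|: B)) v d.
  apply: connect_sub (connect_root v) => x y xy; apply: connect1.
  by rewrite /arc /= in_setU [_ \in T]xy.
by have := acTB (d :: belast v p) isT; rewrite /= [in rcons _ d]lp -lastI /= vp andbT => /negP.
Qed.

(** The members of [S] on an arm form a segment ending at the root, and the one nearest the leaf
    reaches all the others; on an arm without members [d] takes that place. These two vertices form
    the pair. *)
Lemma two_arms_ancestors S : two_arms T d -> d \in S ->
  (forall u v, u \in S -> (u, v) \in T -> v \in S) -> exists s, ancestors s = S.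
Proof.
move=> [l [r [_ _ _ cover defT]]] dS closedS.
have closed u v : u \in S -> connect (arc T) u v -> v \in S.
  move=> uS /connectP[p]; elim: p u uS => [|w p IH] u uS /= => [_ -> //|].
  by move=> /andP[uw]; apply: IH; apply: closedS uw.
have arm q : {subset path_arcs (rcons q d) <= T} ->
    exists2 u, u \in S & forall x, x \in rcons q d -> x \in S -> connect (arc T) u x.
  elim: q => [|y q IH] sub.
    by exists d => // x; rewrite /= inE => /eqP ->; rewrite connect0.
  have [u uS Hu] : exists2 u, u \in S &
      forall x, x \in rcons q d -> x \in S -> connect (arc T) u x.
    apply: IH => a aq; apply: sub; move: aq; case: (q) => [|z q1] //=.
    by rewrite /path_arcs /= inE => ->; rewrite orbT.
  have [yS|yS] := boolP (y \in S); last first.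
    exists u => // x /=; rewrite inE => /orP[/eqP->|]; last exact: Hu.
    by rewrite (negPf yS).
  by exists y => // x xin _; apply: path_connect xin; apply: path_arcs_path.
have [u uS Hu] : exists2 u, u \in S &
    forall x, x \in rcons l d -> x \in S -> connect (arc T) u x.
  by apply: arm => a al; rewrite defT inE mem_cat al.
have [w wS Hw] : exists2 w, w \in S &
    forall x, x \in rcons r d -> x \in S -> connect (arc T) w x.
  by apply: arm => a ar; rewrite defT inE mem_cat ar orbT.
exists (u, w); apply/setP => x; rewrite in_ancestors /=; apply/orP/idP.
  by case=> /closed; apply.
move=> xS; have := cover x; rewrite !inE mem_cat => /or3P[/eqP xd|xl|xr].
- by left; apply: Hu; rewrite // xd mem_rcons mem_head.
- by left; apply: Hu; rewrite // mem_rcons inE xl orbT.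
- by right; apply: Hw; rewrite // mem_rcons inE xr orbT.
Qed.

(** Induction on the number of vertices outside [ancestors s]: a vertex [v] outside whose arcs all
    lead inside is added, and the enlarged set is again closed, hence of the form [ancestors s']. *)
Lemma covered_le_best B s : two_arms T d -> feasible E T B ->
  (forall u v, u \in ancestors s -> (u, v) \in T :|: B -> v \in ancestors s) ->
  #|[set u | covered B u && (u \notin ancestors s)]| <= best s.
Proof.
move=> arms [orB acTB]; move: {2}#|_| (leqnn #|~: ancestors s|) => m.
elim: m s => [|m IH] s.
  rewrite leqn0 cards_eq0 => /eqP full _.
  rewrite [X in X <= _](_ : _ = 0) //; apply/eqP; rewrite cards_eq0; apply/eqP/setP => u.
  by move/setP/(_ u): full; rewrite in_setC !in_set0 in_set => ->; rewrite andbF.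
move=> le_m closed.
have [/eqP full|nfull] := boolP (~: ancestors s == set0).
  by apply: IH; rewrite // full cards0.
have [v] := acyclic_min acTB nfull; rewrite in_setC => vs vmin.
have {}vmin w : (v, w) \in T :|: B -> w \in ancestors s.
  by move=> /vmin; rewrite in_setC negbK.
have dS : d \in ancestors s by rewrite in_ancestors connect_root.
have [s' defs'] : exists s', ancestors s' = v |: ancestors s.
  apply: two_arms_ancestors => //; first by rewrite in_setU1 dS orbT.
  move=> x y; rewrite !in_setU1 => /orP[/eqP->|xs] xy.
    by rewrite vmin ?orbT // in_setU xy.
  by rewrite (ancestors_closed xs xy) orbT.
have prop : ancestors s \proper ancestors s'.
  rewrite defs' properE subsetUr /=; apply/subsetPn; exists v => //.
  by rewrite in_setU1 eqxx.
have le_best : gain s s' + best s' <= best s.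
  rewrite [best s]bestE.
  exact: (@leq_bigmax_cond _ _ (fun s1 => gain s s1 + best s1) _ prop).
apply: leq_trans le_best.
have {}IH : #|[set u | covered B u && (u \notin ancestors s')]| <= best s'.
  apply: IH.
    by have := proper_card prop; have := cardsC (ancestors s); have := cardsC (ancestors s'); lia.
  move=> x y; rewrite defs' !in_setU1 => /orP[/eqP->|xs] xy.
    by rewrite (vmin y xy) orbT.
  by rewrite (closed _ _ xs xy) orbT.
apply: leq_trans (leq_add (leqnn _) IH); rewrite -cardsUI.
apply: leq_trans (leq_addr _ _); apply/subset_leq_card/subsetP => u.
rewrite !in_set => /andP[cu us].
have [uv|uv] := eqVneq u v; last by rewrite cu defs' in_setU1 (negPf uv) us orbT.
(* If [v] is covered, its arc in [B] ends in [ancestors s], so [v] is counted by the gain. *)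
rewrite uv vs defs' in_setU1 eqxx /=; apply/orP; left.
move: cu; rewrite uv => /existsP[x vx]; have [vxE _] := orB _ _ vx.
by apply/existsP; exists x; rewrite vxE vmin // in_setU vx orbT.
Qed.

(** The root has no outgoing arc, so [ancestors (d, d)] contains only [d] and [d] is uncovered;
    counting outside this set loses nothing. *)
Lemma num_covered_le_best B : two_arms T d -> feasible E T B ->
  num_covered B <= best (d, d).
Proof.
move=> arms feasB.
have no_arc v : (d, v) \notin T :|: B by apply: root_no_arc; case: feasB.
have anc_d u : u \in ancestors (d, d) -> u = d.
  rewrite in_ancestors /= orbb => /connectP[[|v p] /=]; first by move=> _ ->.
  by move=> /andP[dv _] _; have := no_arc v; rewrite in_setU [_ \in T]dv.
apply: leq_trans (covered_le_best arms feasB _) => [|u v /anc_d->]; last first.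
  by move=> dv; have := no_arc v; rewrite dv.
apply/subset_leq_card/subsetP => u; rewrite !in_set => cu; rewrite cu.
apply/negP => /anc_d ud; move: cu; rewrite ud => /existsP[v dv].
by have := no_arc v; rewrite in_setU dv orbT.
Qed.

Lemma chain_arcs_optimal : two_arms T d -> optimal E T (chain_arcs #|V|).
Proof.
move=> arms; split; first by split; [exact: chain_arcs_oriented | exact: chain_arcs_acyclic].
move=> B feasB; apply: leq_trans best_le_num_covered.
exact: num_covered_le_best.
Qed.

End Chains.

(** * The dynamic program *)

Definition tnot t := Cond t (Lit 0) (Lit 1).
Definition tand t1 t2 := Cond t1 t2 (Lit 0).
Definition tor t1 t2 := Cond t1 (Lit 1) t2.
Definition timp t1 t2 := Cond t1 t2 (Lit 1).
Definition tex t := Cond (BigSum t) (Lit 1) (Lit 0).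
Definition tall t := tnot (tex (tnot t)).
Definition tle t1 t2 := tnot (Minus t1 t2).
Definition teq t1 t2 := tand (tle t1 t2) (tle t2 t1).
Definition entry k x y := Cell k (Var x) (Var y).

(* In the environment, variable 0 is the root, and 1 and 2 are the indices of  *)
(* the entry being defined.  The arrays are: 0 the edges, 1 the tree, 2 a      *)
(* scratch array, 3 reachability in the tree, 4 [best], 5 and 6 the components *)
(* of [next], 7 the states of the chain, and 8 the solution.                   *)
Definition t_anc x y z := tor (entry 3 x z) (entry 3 y z).
(** Here and below [l] stands for the length of the environment, which is the index of the next
    bound variable. *)
Definition t_sub l x y x' y' := tall (timp (t_anc x y l) (t_anc x' y' l)).
Definition t_proper l x y x' y' :=
  tand (t_sub l x y x' y') (tnot (t_sub l x' y' x y)).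
Definition t_gain l x y x' y' :=
  BigSum (tand (t_anc x' y' l) (tand (tnot (t_anc x y l))
    (tex (tand (t_anc x y l.+1) (entry 0 l l.+1))))).
Definition t_good l x y x' y' :=
  tand (t_sub l x y x' y')
    (tand (tle (entry 4 x y) (Plus (t_gain l x y x' y') (entry 4 x' y')))
      (tor (tnot (entry 4 x y)) (t_proper l x y x' y'))).

Definition t_reach := tor (teq (Var 1) (Var 2)) (tex (tand (entry 1 1 3) (entry 3 3 2))).
Definition t_improve :=
  BigMax (BigMax (tand (t_proper 5 1 2 3 4) (Plus (t_gain 5 1 2 3 4) (entry 4 3 4)))).
(** A maximum serves as choice: it selects the largest first component of a good successor, and
    [t_next2] the largest second component matching it. *)
Definition t_next1 := BigMax (tand (tex (t_good 5 1 2 3 4)) (Var 3)).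
(** Variable 4 is quantified and compared with the stored first component because [t_good] takes
    only variables. *)
Definition t_next2 :=
  BigMax (tand (tex (tand (teq (Var 4) (entry 5 1 2)) (t_good 5 1 2 4 3))) (Var 3)).
(** After i rounds the marked pairs are the states reached from the root pair in fewer than i
    steps. *)
Definition t_chain :=
  tor (tand (teq (Var 1) (Var 0)) (teq (Var 2) (Var 0)))
    (tex (tex (tand (entry 7 3 4)
      (tand (teq (entry 5 3 4) (Var 1)) (teq (entry 6 3 4) (Var 2)))))).
Definition t_solution :=
  tand (entry 0 1 2)
    (tex (tex (tand (entry 7 3 4) (tand (t_anc 3 4 2) (tnot (t_anc 3 4 1)))))).

(** The detour through scratch array 2 lets [t] read array [k]. *)
Definition iterate k t := Repeat (Then (Define 2 t) (Define k (entry 2 1 2))).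

Definition solver : program :=
  Then (iterate 3 t_reach) (Then (iterate 4 t_improve)
    (Then (Define 5 t_next1) (Then (Define 6 t_next2)
      (Then (iterate 7 t_chain) (Define 8 t_solution))))).

(** * Values of the formulas *)

Section Evaluation.

Variables (n : nat) (d : 'I_n).
Implicit Types (a : arrays) (es : seq 'I_n) (t : term).

Definition ev a es t : nat := teval n a (map val es) t.

Lemma ev_tand a es t1 t2 (b1 : bool) m :
  ev a es t1 = b1 -> ev a es t2 = m -> ev a es (tand t1 t2) = if b1 then m else 0.
Proof. by rewrite /ev /= => -> ->; case: b1. Qed.

Lemma ev_tandb a es t1 t2 (b1 b2 : bool) :
  ev a es t1 = b1 -> ev a es t2 = b2 -> ev a es (tand t1 t2) = b1 && b2.
Proof. by rewrite /ev /= => -> ->; case: b1. Qed.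

Lemma ev_tor a es t1 t2 (b1 b2 : bool) :
  ev a es t1 = b1 -> ev a es t2 = b2 -> ev a es (tor t1 t2) = b1 || b2.
Proof. by rewrite /ev /= => -> ->; case: b1. Qed.

Lemma ev_timp a es t1 t2 (b1 b2 : bool) :
  ev a es t1 = b1 -> ev a es t2 = b2 -> ev a es (timp t1 t2) = (b1 ==> b2).
Proof. by rewrite /ev /= => -> ->; case: b1. Qed.

Lemma ev_tnot a es t m : ev a es t = m -> ev a es (tnot t) = (m == 0).
Proof. by rewrite /ev /= => ->; case: eqP. Qed.

Lemma ev_tnotb a es t (b : bool) : ev a es t = b -> ev a es (tnot t) = ~~ b.
Proof. by move/ev_tnot ->; case: b. Qed.

Lemma ev_bigsum a es t (F : 'I_n -> nat) :
  (forall i, ev a (rcons es i) t = F i) -> ev a es (BigSum t) = \sum_i F i.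
Proof. by move=> H; apply: eq_bigr => i _; rewrite -H /ev map_rcons. Qed.

Lemma ev_bigmax a es t (F : 'I_n -> nat) :
  (forall i, ev a (rcons es i) t = F i) -> ev a es (BigMax t) = \max_i F i.
Proof. by move=> H; apply: eq_bigr => i _; rewrite -H /ev map_rcons. Qed.

Lemma ev_tex a es t (b : 'I_n -> bool) :
  (forall i, ev a (rcons es i) t = b i) -> ev a es (tex t) = [exists i, b i].
Proof.
move=> /ev_bigsum; rewrite /ev /= => ->.
case: existsP => [[i bi]|nb]; first by rewrite (bigD1 i) //= bi.
by rewrite big1 // => i _; case: (boolP (b i)) => // bi; case: nb; exists i.
Qed.

Lemma ev_tall a es t (b : 'I_n -> bool) :
  (forall i, ev a (rcons es i) t = b i) -> ev a es (tall t) = [forall i, b i].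
Proof.
move=> H; rewrite (ev_tnotb (ev_tex (b := fun i => ~~ b i) _)) ?negb_exists.
  by congr nat_of_bool; apply: eq_forallb => i; rewrite negbK.
by move=> i; apply: ev_tnotb.
Qed.

Lemma ev_plus a es t1 t2 m1 m2 :
  ev a es t1 = m1 -> ev a es t2 = m2 -> ev a es (Plus t1 t2) = m1 + m2.
Proof. by move=> <- <-. Qed.

Lemma ev_tle a es t1 t2 m1 m2 :
  ev a es t1 = m1 -> ev a es t2 = m2 -> ev a es (tle t1 t2) = (m1 <= m2).
Proof. by move=> <- <-; apply: ev_tnot. Qed.

Lemma ev_teq a es t1 t2 m1 m2 :
  ev a es t1 = m1 -> ev a es t2 = m2 -> ev a es (teq t1 t2) = (m1 == m2).
Proof. by move=> h1 h2; rewrite (ev_tandb (ev_tle h1 h2) (ev_tle h2 h1)) -eqn_leq. Qed.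

Lemma ev_var a es x : x < size es -> ev a es (Var x) = nth d es x.
Proof. by move=> ltx; rewrite /ev /= (nth_map d). Qed.

Lemma ev_entry a es k x y : x < size es -> y < size es ->
  ev a es (entry k x y) = a k (nth d es x) (nth d es y).
Proof. by move=> ltx lty; rewrite /ev /= !(nth_map d) // !ltn_ord. Qed.

(** [f i] describes array [k] after i rounds; apart from it only the scratch array changes. *)
Lemma prun_iterate k t a (f : nat -> 'I_n -> 'I_n -> nat) :
    k != 2 -> (forall u v : 'I_n, a k u v = f 0 u v) ->
    (forall i a', (forall j, j \notin [:: 2; k] -> a' j = a j) ->
      (forall u v : 'I_n, a' k u v = f i u v) ->
      forall u v, ev a' [:: d; u; v] t = f i.+1 u v) ->
  let a' := prun n d (iterate k t) a in
  (forall j, j \notin [:: 2; k] -> a' j = a j) /\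
  forall u v : 'I_n, a' k u v = f n u v.
Proof.
move=> k2 f0 fS; pose step := prun n d (Then (Define 2 t) (Define k (entry 2 1 2))).
suff H i : (forall j, j \notin [:: 2; k] -> iter i step a j = a j) /\
    forall u v : 'I_n, iter i step a k u v = f i u v by exact: H.
elim: i => [//|i [IHj IHk]]; split=> [j|u v].
  rewrite !inE negb_or /= => /andP[/negPf j2 /negPf jk].
  by rewrite {1}/step /= jk j2 IHj // !inE j2 jk.
by rewrite iterS {1}/step /= eqxx !ltn_ord /= -(fS _ _ IHj IHk).
Qed.

(** Indices failing [b] contribute 0, which never exceeds the largest index satisfying it. *)
Lemma max_witness (b : 'I_n -> bool) : (exists i, b i) ->
  exists2 i, b i & \max_i (if b i then i : nat else 0) = i.
Proof.
move=> [i0 bi0]; rewrite -big_mkcond (bigmax_eq_arg i0) //.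
by case: arg_maxnP => // i bi _; exists i.
Qed.

End Evaluation.

(** * Reachability by rounds *)

Section Reach.

Variables (V : finType) (T : {set V * V}).

(** Stage 0 is empty because the work arrays initially read as 0; stage i thus captures walks with
    fewer than i arcs. *)
Fixpoint reach i (u v : V) : bool :=
  if i is i'.+1 then (u == v) || [exists y, ((u, y) \in T) && reach i' y v] else false.

(** A walk can be shortened to a path without repetition, which has fewer than [#|V|] arcs. *)
Lemma reachE u v : reach #|V| u v = connect (arc T) u v.
Proof.
apply/idP/connectP => [|[p up ->]].
  elim: #|V| u => //= i IH u /orP[/eqP<-|/existsP[y /andP[uy /IH[p yp ->]]]].
    by exists [::].
  by exists (y :: p); rewrite //= yp andbT.
case: (shortenP up) => q uq /card_uniqP /= sz _.
have: size q < #|V| by rewrite -sz max_card.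
elim: #|V| q u uq {p up sz} => //= i IH [|y q] u /=; first by rewrite eqxx.
move=> /andP[uy yq] szq; apply/orP; right; apply/existsP; exists y.
by rewrite [_ \in T]uy IH.
Qed.

End Reach.

(** * Correctness of the dynamic program *)

Section Solver.

Variables (n : nat) (d : 'I_n) (E : {set {set 'I_n}}) (T : {set 'I_n * 'I_n}).
Implicit Types (a : arrays) (es : seq 'I_n).

Local Notation ancestors := (ancestors T).
Local Notation node es x y := (nth d es x, nth d es y).

Lemma nth_env es i x : x < size es -> nth d (rcons es i) x = nth d es x.
Proof. by move=> ltx; rewrite nth_rcons ltx. Qed.

Lemma nth_env_last es i : nth d (rcons es i) (size es) = i.
Proof. by rewrite nth_rcons ltnn eqxx. Qed.

Section Terms.

Variable a : arrays.
Hypothesis aE : forall u v : 'I_n, a 0 u v = ([set u; v] \in E).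
Hypothesis aP : forall u v : 'I_n, a 3 u v = connect (arc T) u v.

Lemma ev_anc es x y z : x < size es -> y < size es -> z < size es ->
  ev a es (t_anc x y z) = (nth d es z \in ancestors (node es x y)).
Proof.
by move=> ltx lty ltz; rewrite in_ancestors; apply: ev_tor; rewrite (ev_entry d) ?aP.
Qed.

Lemma ev_sub es x y x' y' : all (gtn (size es)) [:: x; y; x'; y'] ->
  ev a es (t_sub (size es) x y x' y') =
  (ancestors (node es x y) \subset ancestors (node es x' y')).
Proof.
move=> /and5P[/= ltx lty ltx' lty' _].
rewrite (@ev_tall _ _ _ _ (fun z =>
  (z \in ancestors (node es x y)) ==> (z \in ancestors (node es x' y')))).
  congr nat_of_bool; apply/forallP/subsetP => sub z.
    by move=> zs; have := sub z; rewrite zs.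
  by apply/implyP; apply: sub.
move=> z; apply: ev_timp; rewrite ev_anc ?size_rcons // ?ltnS ?(ltnW ltx) ?(ltnW lty)
  ?(ltnW ltx') ?(ltnW lty') // nth_env_last !nth_env //.
Qed.

Lemma ev_proper es x y x' y' : all (gtn (size es)) [:: x; y; x'; y'] ->
  ev a es (t_proper (size es) x y x' y') =
  (ancestors (node es x y) \proper ancestors (node es x' y')).
Proof.
move=> lt; rewrite properE; apply: ev_tandb; first exact: ev_sub.
apply: ev_tnotb; apply: ev_sub.
by case/and5P: lt => /= -> -> -> ->.
Qed.

Lemma ev_gain es x y x' y' : all (gtn (size es)) [:: x; y; x'; y'] ->
  ev a es (t_gain (size es) x y x' y') = gain E T (node es x y) (node es x' y').
Proof.
move=> /and5P[/= ltx lty ltx' lty' _].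
rewrite /gain cardsE -sum1_card big_mkcond; apply: ev_bigsum => v.
rewrite unfold_in /= -[RHS]/(nat_of_bool _).
apply: ev_tandb.
  by rewrite ev_anc ?size_rcons ?ltnS ?(ltnW ltx') ?(ltnW lty') // nth_env_last !nth_env.
apply: ev_tandb.
  apply: ev_tnotb.
  by rewrite ev_anc ?size_rcons ?ltnS ?(ltnW ltx) ?(ltnW lty) // nth_env_last !nth_env.
apply: ev_tex => z; have sz : size (rcons es v) = (size es).+1 by rewrite size_rcons.
apply: ev_tandb.
  rewrite ev_anc ?size_rcons ?ltnS ?leqW ?(ltnW ltx) ?(ltnW lty) //.
  by rewrite -sz nth_env_last !nth_env ?size_rcons ?ltnS ?(ltnW ltx) ?(ltnW lty).
rewrite (ev_entry d) ?size_rcons ?leqnn ?leqnSn // aE.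
by rewrite -sz nth_env_last nth_env ?size_rcons // nth_env_last.
Qed.

Hypothesis aG : forall u v : 'I_n, a 4 u v = best E T (u, v).

Lemma ev_good es x y x' y' : all (gtn (size es)) [:: x; y; x'; y'] ->
  ev a es (t_good (size es) x y x' y') = good E T (node es x y) (node es x' y').
Proof.
move=> lt; have /and5P[/= ltx lty ltx' lty' _] := lt.
apply: ev_tandb; first exact: ev_sub.
apply: ev_tandb.
  apply: ev_tle; first by rewrite (ev_entry d) ?aG.
  by apply: ev_plus; [exact: ev_gain | rewrite (ev_entry d) ?aG].
apply: ev_tor; last exact: ev_proper.
by apply: ev_tnot; rewrite (ev_entry d) ?aG.
Qed.

End Terms.

Lemma improve_pairs g (s : 'I_n * 'I_n) : improve E T g s =
  \max_x \max_y if ancestors s \proper ancestors (x, y)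
                then gain E T s (x, y) + g (x, y) else 0.
Proof.
rewrite pair_bigA /= /improve big_mkcond.
by apply: eq_bigr => -[x y] _.
Qed.

(** The function [next] is not fixed in advance: it is whatever arrays 5 and 6 hold, and optimality
    uses only that its steps are [good]. *)
Lemma run_solver a0 :
    (forall u v : 'I_n, a0 0 u v = ([set u; v] \in E)) ->
    (forall u v : 'I_n, a0 1 u v = ((u, v) \in T)) ->
    (forall k (u v : 'I_n), 1 < k -> a0 k u v = 0) ->
  exists2 next, forall s, good E T s (next s) &
    forall u v : 'I_n, prun n d solver a0 8 u v = ((u, v) \in chain_arcs E T d next n).
Proof.
move=> E0 T0 Z0.
set a1 := prun n d (iterate 3 t_reach) a0.
have [||f1 P1] := @prun_iterate n d 3 t_reach a0 (fun i u v => reach T i u v) isT.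
- by move=> u v; rewrite Z0.
- move=> i a fa a3 u v /=; apply: ev_tor.
    by apply: ev_teq; rewrite (ev_var d).
  apply: ev_tex => y; apply: ev_tandb; rewrite (ev_entry d) //= ?a3 //.
  by rewrite fa.
rewrite -/a1 in f1 P1.
have {}P1 (u v : 'I_n) : a1 3 u v = connect (arc T) u v.
  by rewrite P1 -reachE card_ord.
have E1 (u v : 'I_n) : a1 0 u v = ([set u; v] \in E) by rewrite f1.
set a2 := prun n d (iterate 4 t_improve) a1.
have [||f2 G2] := @prun_iterate n d 4 t_improve a1
  (fun i u v => iter i (improve E T) (fun=> 0) (u, v)) isT.
- by move=> u v; rewrite f1 // Z0.
- move=> i a fa a4 u v; rewrite iterS improve_pairs.
  apply: ev_bigmax => x; apply: ev_bigmax => y.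
  have aE u' v' : a 0 (val u') (val v') = ([set u'; v'] \in E) by rewrite fa ?E1.
  have aP u' v' : a 3 (val u') (val v') = connect (arc T) u' v' by rewrite fa ?P1.
  apply: ev_tand; first exact: (@ev_proper a aP [:: d; u; v; x; y] 1 2 3 4 isT).
  apply: ev_plus; first exact: (@ev_gain a aE aP [:: d; u; v; x; y] 1 2 3 4 isT).
  by rewrite (ev_entry d) ?a4.
rewrite -/a2 in f2 G2.
have {}G2 (u v : 'I_n) : a2 4 u v = best E T (u, v) by rewrite G2 /best card_ord.
have P2 (u v : 'I_n) : a2 3 u v = connect (arc T) u v by rewrite f2.
have E2 (u v : 'I_n) : a2 0 u v = ([set u; v] \in E) by rewrite f2.
set a3 := prun n d (Define 5 t_next1) a2.
have N1 (s : 'I_n * 'I_n) : exists2 u' : 'I_n,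
    a3 5 s.1 s.2 = u' & exists w', good E T s (u', w').
  have [|u' /existsP[w' good_s] max_u] :=
      @max_witness n (fun u' => [exists w', good E T s (u', w')]).
    have [[u' w'] good_s] := good_exists E T s.
    by exists u'; apply/existsP; exists w'.
  exists u'; last by exists w'.
  have -> : a3 5 s.1 s.2 = ev a2 [:: d; s.1; s.2] t_next1 by [].
  rewrite -max_u; apply: (@ev_bigmax n a2 [:: d; s.1; s.2]) => x.
  apply: ev_tand; last by rewrite (ev_var d).
  apply: ev_tex => y.
  have := @ev_good a2 E2 P2 G2 [:: d; s.1; s.2; x; y] 1 2 3 4 isT.
  by rewrite /= -surjective_pairing.
set a4 := prun n d (Define 6 t_next2) a3.
have N2 (s : 'I_n * 'I_n) : exists s' : 'I_n * 'I_n,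
    [/\ a4 5 s.1 s.2 = s'.1, a4 6 s.1 s.2 = s'.2 & good E T s s'].
  have [u' eu' [w0 good_w0]] := N1 s.
  have [|w' good_s max_w] := @max_witness n (fun w' => good E T s (u', w')); first by exists w0.
  exists (u', w'); split=> //.
  have -> : a4 6 s.1 s.2 = ev a3 [:: d; s.1; s.2] t_next2 by [].
  rewrite -max_w; apply: (@ev_bigmax n a3 [:: d; s.1; s.2]) => w.
  apply: ev_tand; last by rewrite (ev_var d).
  have -> : good E T s (u', w) = [exists u1 : 'I_n, (u1 == u' :> nat) && good E T s (u1, w)].
    apply/idP/existsP => [gw|[u1 /andP[/eqP/val_inj ->]] //].
    by exists u'; rewrite eqxx.
  apply: ev_tex => u1; apply: ev_tandb.
    by apply: ev_teq; [rewrite (ev_var d) | rewrite (ev_entry d)].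
  have := @ev_good a3 E2 P2 G2 [:: d; s.1; s.2; w; u1] 1 2 4 3 isT.
  by rewrite /= -surjective_pairing.
(* The pairs stored in arrays 5 and 6 are collected into one function. *)
have [next Hnext] := fin_all_exists N2.
have N5 (s : 'I_n * 'I_n) : a4 5 s.1 s.2 = (next s).1 by case: (Hnext s).
have N6 (s : 'I_n * 'I_n) : a4 6 s.1 s.2 = (next s).2 by case: (Hnext s).
exists next => [s|]; first by case: (Hnext s).
have E4 (u v : 'I_n) : a4 0 u v = ([set u; v] \in E) by exact: E2.
have P4 (u v : 'I_n) : a4 3 u v = connect (arc T) u v by exact: P2.
set a5 := prun n d (iterate 7 t_chain) a4.
have [||f5 H5] := @prun_iterate n d 7 t_chain a4
  (fun i u v => [exists k : 'I_i, iter k next (d, d) == (u, v)]) isT.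
- move=> u v; have -> : a4 7 u v = 0 by rewrite /a4 /a3 /= f2 // f1 // Z0.
  by rewrite [in RHS](_ : [exists _, _] = false) //; apply/existsP => -[[]].
- move=> i a fa a7 u v.
  have -> : [exists k : 'I_i.+1, iter k next (d, d) == (u, v)] =
      (u == d :> nat) && (v == d :> nat) || [exists x, [exists y,
        [exists k : 'I_i, iter k next (d, d) == (x, y)] &&
        (((next (x, y)).1 == u :> nat) && ((next (x, y)).2 == v :> nat))]].
    apply/existsP/idP => [[[[|k] ltk] /= /eqP eqk]|].
    - by case: eqk => <- <-; rewrite eqxx.
    - apply/orP; right; apply/existsP; exists (iter k next (d, d)).1.
      apply/existsP; exists (iter k next (d, d)).2.
      rewrite -surjective_pairing eqk !eqxx !andbT.
      by apply/existsP; exists (Ordinal (ltk : k < i)).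
    case/orP=> [/andP[/eqP/val_inj-> /eqP/val_inj->]|]; first by exists ord0.
    case/existsP=> x /existsP[y /andP[/existsP[k /eqP eqk]]].
    move=> /andP[/eqP/val_inj eu /eqP/val_inj ev_].
    have ltk : k.+1 < i.+1 by rewrite ltnS.
    by exists (Ordinal ltk); rewrite /= eqk -eu -ev_ -surjective_pairing.
  apply: ev_tor.
    by apply: ev_tandb; apply: ev_teq; rewrite (ev_var d).
  apply: ev_tex => x; apply: ev_tex => y; apply: ev_tandb.
    by rewrite (ev_entry d) // a7.
  apply: ev_tandb; apply: ev_teq; rewrite ?(ev_var d) // (ev_entry d) // fa //.
    exact: (N5 (x, y)).
  exact: (N6 (x, y)).
rewrite -/a5 in f5 H5.
move=> u v; rewrite -[prun n d solver a0]/(prun n d (Define 8 t_solution) a5).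
have -> : prun n d (Define 8 t_solution) a5 8 u v = ev a5 [:: d; u; v] t_solution by [].
rewrite inE /=.
set chain := fun k => iter k next (d, d).
have -> : [exists k : 'I_n, (v \in ancestors (chain k)) && (u \notin ancestors (chain k))] =
    [exists x, [exists y, [exists k : 'I_n, chain k == (x, y)] &&
      ((v \in ancestors (x, y)) && (u \notin ancestors (x, y)))]].
  apply/existsP/existsP => [[k uvk]|[x /existsP[y /andP[/existsP[k /eqP eqk] uvk]]]].
    exists (chain k).1; apply/existsP; exists (chain k).2.
    by rewrite -surjective_pairing uvk andbT; apply/existsP; exists k.
  by exists k; rewrite eqk.
apply: ev_tandb; first by rewrite (ev_entry d) // f5.
have P5 (u' v' : 'I_n) : a5 3 u' v' = connect (arc T) u' v' by rewrite f5.
apply: ev_tex => x; apply: ev_tex => y; apply: ev_tandb.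
  by rewrite (ev_entry d) // H5.
apply: ev_tandb; first exact: (@ev_anc a5 P5 [:: d; u; v; x; y] 3 4 2).
by apply: ev_tnotb; exact: (@ev_anc a5 P5 [:: d; u; v; x; y] 3 4 1).
Qed.

End Solver.

(** * Row-major coding and the final assembly *)

Lemma nth_allpairs (S1 S2 : Type) (f : S1 -> S2 -> nat) x1 x2 s1 s2 i j :
  i < size s1 -> j < size s2 ->
  nth 0 [seq f x y | x <- s1, y <- s2] (i * size s2 + j) = f (nth x1 s1 i) (nth x2 s2 j).
Proof.
move=> lti ltj; elim: s1 i lti => //= x s1 IH [|i] lti.
  by rewrite nth_cat size_map ltj (nth_map x2).
by rewrite nth_cat size_map mulSn -addnA ltnNge leq_addr /= addKn IH.
Qed.

Lemma nth_matrix_code (n : nat) (f : rel 'I_n) (u v : 'I_n) :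
  nth 0 (matrix_code f) (u * n + v) = f u v.
Proof.
have := @nth_allpairs _ _ (fun x y => nat_of_bool (f x y)) u u (enum 'I_n) (enum 'I_n) u v.
by rewrite !size_enum_ord !nth_ord_enum; apply.
Qed.

Lemma size_matrix_code (n : nat) (f : rel 'I_n) : size (matrix_code f) = n * n.
Proof. by rewrite size_allpairs size_enum_ord. Qed.

Theorem theorem6 :
  solvable_in_poly_time two_arm_instance optimal_solution
    graph_code solution_code.
Proof.
have [|//|prog [a [k H]]] := @program_in_poly_time solver 8; first by [].
exists prog, a, k => G [[_ treeG] armsG].
pose n := order G; pose d := Defs.root G; pose w := graph_code G.
have [t [s [Et le_t sE]]] := H w.
have size_w : size w = (n * n + n * n).+2 by rewrite /= size_cat !size_matrix_code.
have [|||next next_good nextE] :=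
    @run_solver n d (edges G) (tree G) (fun k u v => nth 0 w (cell 2 n k u v)).
- move=> u v; rewrite /cell muln0 addn0 -addnA add2n /= nth_cat size_matrix_code.
  rewrite addnC mulnC ifT ?nth_matrix_code //.
  by have := ltn_ord u; have := ltn_ord v; rewrite /n; nia.
- move=> u v; rewrite /cell muln1 -addnA add2n /= nth_cat size_matrix_code.
  rewrite ifF; last by rewrite /n; nia.
  rewrite (_ : _ - _ = u * n + v) ?nth_matrix_code // /n; nia.
(* Arrays from index 2 on lie beyond the input word, where the memory reads as 0. *)
- move=> j u v lt1j; rewrite nth_default // size_w /cell; nia.
exists t, s, (chain_arcs (edges G) (tree G) d next n); split=> //.
- apply: leq_trans le_t _; rewrite leq_add2r leq_mul2l; apply/orP; right.
  have -> : nth 0 w 0 = n by [].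
  (* The input word has length 2 * n * n + 2, at least n + 1; comparing the powers through
     [leq_exp2r] needs a positive exponent. *)
  have [->|k0] := posnP k; first by rewrite !expn0.
  by rewrite leq_exp2r // size_w; nia.
- have := @chain_arcs_optimal _ (edges G) (tree G) d next next_good treeG armsG.
  by rewrite card_ord.
move=> i; rewrite size_matrix_code => lti.
have n0 : 0 < n by move: lti; rewrite -/n; case: (n).
have ltu : i %/ n < n by rewrite ltn_divLR.
have ltv : i %% n < n by rewrite ltn_mod.
rewrite (divn_eq i n) sE // (nextE (Ordinal ltu) (Ordinal ltv)).
by rewrite (nth_matrix_code _ (Ordinal ltu) (Ordinal ltv)).
Qed.
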